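(* Let $(X,d)$ be a metric space, let $T:X\rightarrow CB(X)$ be a multivalued \'{C}iri\'{c} type $F_{C}$-contraction with $x_{0}\in X$, and let $$r=\inf \left\{ H(Tx,\{x\}): x\in X,\ H(Tx,\{x\})>0\right\}.$$ If $D(x_{0},Tx)=r$ for all $x\in C_{x_{0},r}$, then the circle $C_{x_{0},r}$ is a fixed circle of $T$.
   Context: For a metric space $(X,d)$, $CB(X)$ is the family of all nonempty, closed and bounded subsets of $X$. For $x\in X$ and $B\in CB(X)$, $D(x,B)=\inf\{d(x,y):y\in B\}$, and for $A,B\in CB(X)$, $H(A,B)=\max\{\sup_{x\in A}D(x,B),\sup_{y\in B}D(y,A)\}$ is the Hausdorff metric induced by $d$. The circle is $C_{x_{0},r}=\{x\in X:d(x,x_{0})=r\}$. A circle $C_{x_{0},r}$ is a fixed circle of $T:X\to CB(X)$ if $x\in Tx$ for each $x\in C_{x_{0},r}$. $\mathcal{F}$ is the family of all functions $F:(0,\infty)\to\mathbb{R}$ such that: (F1) $F$ is strictly increasing; (F2) for each sequence $\{\alpha_n\}$ in $(0,\infty)$, $\lim_{n\to\infty}\alpha_n=0$ if and only if $\lim_{n\to\infty}F(\alpha_n)=-\infty$; (F3) there exists $k\in(0,1)$ with $\lim_{\alpha\to0^+}\alpha^kF(\alpha)=0$. For $x,y\in X$ put $M(x,y)=\max\left\{d(x,y),D(x,Tx),D(y,Ty),\tfrac12[D(x,Ty)+D(y,Tx)]\right\}$. $T:X\to CB(X)$ is a multivalued \'{C}iri\'{c} type $F_{C}$-contraction with $x_0\in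 X$ if there exist $F\in\mathcal{F}$ and $\tau>0$ such that for all $x\in X$: $H(Tx,\{x\})>0$ implies $\tau+F(H(Tx,\{x\}))\leq F(M(x,x_{0}))$. Since $F$ is defined only on $(0,\infty)$, the inequality is understood to include the requirement that its right-hand side is defined, i.e. $M(x,x_0)>0$. *)

(* Defs.v *)
From HB Require Import structures.
From mathcomp Require Import all_boot all_order all_algebra.
From mathcomp Require Import all_classical all_reals all_analysis.

Set Implicit Arguments.
Unset Strict Implicit.
Unset Printing Implicit Defensive.

Import Order.TTheory GRing.Theory Num.Theory.
Import numFieldNormedType.Exports.

Local Open Scope classical_set_scope.
Local Open Scope ring_scope.

Section MultivaluedFCContraction.
Context {R : realType} {X : metricType R}.

Definition metric_bounded (A : set X) : Prop :=
  exists M : R, forall x y, A x -> A y -> mdist x y <= M.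

Definition CB : set (set X) :=
  [set A | [/\ A !=set0, closed A & metric_bounded A]].

(* On CB X the inf and the sups below are taken over nonempty bounded sets of
   reals, so the default values of the total operators inf and sup never occur. *)
Definition pt_set_dist (x : X) (B : set X) : R := inf [set mdist x y | y in B].

Definition hausdorff_dist (A B : set X) : R :=
  Num.max (sup [set pt_set_dist x B | x in A])
          (sup [set pt_set_dist y A | y in B]).

Definition circle (x0 : X) (r : R) : set X := [set x | mdist x x0 = r].

Definition fixed_circle (T : X -> set X) (x0 : X) (r : R) : Prop :=
  forall x, circle x0 r x -> T x x.

Definition ciric_max (T : X -> set X) (x y : X) : R :=
  Num.max (mdist x y)
    (Num.max (pt_set_dist x (T x))
      (Num.max (pt_set_dist y (T y))
        (2^-1 * (pt_set_dist x (T y) + pt_set_dist y (T x))))).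

(* A function (0, oo) -> R is represented by a total function on R of which
   only the values at positive arguments are ever constrained or used. *)
Definition F_family : set (R -> R) :=
  [set F | [/\ (forall a b : R, 0 < a -> a < b -> F a < F b),
      (forall alpha : nat -> R, (forall n, 0 < alpha n) ->
         (alpha n @[n --> \oo] --> (0 : R)) <->
         (F (alpha n) @[n --> \oo] --> -oo)) &
      (exists k : R, 0 < k < 1 /\
         (a `^ k * F a @[a --> (0 : R)^'+] --> (0 : R)))]].

(* The conjunct [0 < ciric_max T x x0] says that the right-hand side of the
   inequality is defined. *)
Definition ciric_FC_contraction (T : X -> set X) (x0 : X) : Prop :=
  exists F : R -> R, exists tau : R, [/\ F_family F, 0 < tau &
    forall x : X, 0 < hausdorff_dist (T x) [set x] ->
      0 < ciric_max T x x0 /\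
      tau + F (hausdorff_dist (T x) [set x]) <= F (ciric_max T x x0)].

(* If T x = {x} for every x, the set below is empty and MathComp's convention
   inf set0 = 0 applies; each point is then a fixed point of T, so nothing
   depends on that convention. *)
Definition FC_radius (T : X -> set X) : R :=
  inf [set hausdorff_dist (T x) [set x] | x in
        [set x | 0 < hausdorff_dist (T x) [set x]]].

End MultivaluedFCContraction.

Arguments CB {R} X.

(* Main.v *)
(* Testing the contraction at x0 itself gives M(x0, x0) = D(x0, T x0), which is
   at most H(T x0, {x0}); as F is increasing and tau > 0, this forces
   T x0 = {x0}.  Now let x be on the circle and suppose h = H(T x, {x}) > 0.
   Then r <= h, D(x, T x) <= h, D(x0, T x0) = 0, and the averaged term of
   M(x, x0) is (r + r) / 2, so M(x, x0) <= h, the same contradiction. *)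
Require Import Defs.
From HB Require Import structures.
From mathcomp Require Import all_boot all_order all_algebra.
From mathcomp Require Import all_classical all_reals all_analysis.

Set Implicit Arguments.
Unset Strict Implicit.
Unset Printing Implicit Defensive.

Import Order.TTheory GRing.Theory Num.Theory.
Import numFieldNormedType.Exports.

Local Open Scope classical_set_scope.
Local Open Scope ring_scope.

Section HausdorffToPoint.
Context {R : realType} {X : metricType R}.
Implicit Types (A : set X) (x y : X).

Lemma pt_set_dist_set1 x y : pt_set_dist x [set y] = mdist x y.
Proof. by rewrite /pt_set_dist image_set1 inf1. Qed.

Lemma pt_set_dist_le_hausdorff x A :
  pt_set_dist x A <= hausdorff_dist A [set x].
Proof. by rewrite /hausdorff_dist image_set1 sup1 le_max lexx orbT. Qed.

(** Boundedness of [A] makes the first [sup] a genuine upper bound: by the triangle inequality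
    through [y], the distances from [A] to [x] are at most [M + mdist y x]. *)
Lemma mdist_le_hausdorff x y A :
  metric_bounded A -> A y -> mdist y x <= hausdorff_dist A [set x].
Proof.
move=> [M AM] Ay; rewrite /hausdorff_dist le_max; apply/orP; left.
apply: ub_le_sup; last by exists y => //; rewrite pt_set_dist_set1.
exists (M + mdist y x) => _ [z Az <-]; rewrite pt_set_dist_set1.
by rewrite (le_trans (metric_triangle z y x))// lerD2r AM.
Qed.

(** All points of [A] are at distance 0 from [x], and nonemptiness puts [x] in [A]. The form [<= 0]
    is the negation of the contraction's premise. *)
Lemma hausdorff_le0_eq x A :
  CB X A -> hausdorff_dist A [set x] <= 0 -> A = [set x].
Proof.
move=> [[a Aa] _ bA] H0.
have Ax y : A y -> y = x.
  move=> Ay; apply/mdist_positivity/eqP; rewrite eq_le mdist_ge0 andbT.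
  exact: le_trans (mdist_le_hausdorff x bA Ay) H0.
by apply/seteqP; split => [y /Ax//|_ ->]; rewrite -(Ax a Aa).
Qed.

Lemma FC_radius_le (T : X -> set X) x :
  0 < hausdorff_dist (T x) [set x] ->
  FC_radius T <= hausdorff_dist (T x) [set x].
Proof.
by move=> hx; apply: ge_inf; [exists 0 => _ [z /ltW hz <-]|exists x].
Qed.

Lemma ciric_FC_contraction_eq (T : X -> set X) x0 x :
  CB X (T x) -> ciric_FC_contraction T x0 ->
  (0 < hausdorff_dist (T x) [set x] ->
    ciric_max T x x0 <= hausdorff_dist (T x) [set x]) ->
  T x = [set x].
Proof.
move=> CBTx [F [tau [[Fincr _ _] tau0 FC]]] Mle.
apply: hausdorff_le0_eq => //; rewrite leNgt; apply/negP => h0.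
have [M0] := FC x h0; apply/negP; rewrite -ltNge.
have FM : F (ciric_max T x x0) <= F (hausdorff_dist (T x) [set x]).
  (* (F1) is strict and restricted to positive arguments: equality is split off, and [M0] covers the
     strict case. *)
  have := Mle h0; rewrite le_eqVlt => /predU1P[->//|Mlt].
  by rewrite ltW// Fincr.
by rewrite (le_lt_trans FM)// ltrDr.
Qed.

End HausdorffToPoint.

Theorem theorem2p3 (R : realType) (X : metricType R) (T : X -> set X)
    (hT : forall x : X, CB X (T x)) (x0 : X)
    (hC : ciric_FC_contraction T x0) (r : R) (hr : r = FC_radius T)
    (hD : forall x : X, circle x0 r x -> pt_set_dist x0 (T x) = r) :
  fixed_circle T x0 r.
Proof.
have Tx0 : T x0 = [set x0].
  apply: ciric_FC_contraction_eq hC _ => // h0.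
  rewrite /ciric_max mdistxx mulrC mulrDl -splitr.
  by rewrite !maxxx ge_max ltW//= pt_set_dist_le_hausdorff.
move=> x xr.
suff -> : T x = [set x] by [].
apply: ciric_FC_contraction_eq hC _ => // h0.
have rh : r <= hausdorff_dist (T x) [set x] by rewrite hr FC_radius_le.
(* In the averaged term, one [r] comes from [hD]; the other is [pt_set_dist x (T x0)], which [Tx0]
   reduces to [mdist x x0]. *)
rewrite /ciric_max (hD x)// Tx0 !pt_set_dist_set1 mdistxx xr.
rewrite mulrC mulrDl -splitr.
by rewrite !ge_max rh pt_set_dist_le_hausdorff ltW.
Qed.
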